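(* Let $h$ be a differentiable superfunction whose coefficients all lie in $L_1(\mathbb{R}^m)$, satisfying $L_{ij}h=0$ for all $1\le i\le j\le m+2n$, and let $f$ be the function with $f(r^2)$ equal to the body of $h$. Then $h=f(R^2)$ and \[ \int_{\mathbb{R}^{m|2n}}h= \begin{cases} \int_{\mathbb{R}^{M}}f(|\underline{y}|^2)\,dV(\underline{y}) & \text{if } M>0,\\ (-\pi)^{M/2}f^{(-M/2)}(0) & \text{if } M\in\{0,-2,-4,\dots\},\\ 2(-\pi)^{\frac{M-1}{2}}\int_{0}^\infty f^{(\frac{1-M}{2})}(r^2)\,dr & \text{if } M\in\{-1,-3,-5,\dots\}, \end{cases} \] where $dV(\underline y)$ is Lebesgue measure on $\mathbb{R}^M$.
   Context: Fix integers $m\ge1$, $n\ge0$ and put $M=m-2n$. Let $\Lambda_{2n}$ be the complex Grassmann algebra generated by anticommuting variables ${x\grave{}}_1,\dots,{x\grave{}}_{2n}$. A superfunction on $\mathbb{R}^m$ is $f=\sum_{A}{x\grave{}}_Af_A$, $A\in\{0,1\}^{2n}$, ${x\grave{}}_A={x\grave{}}_1^{\alpha_1}\cdots{x\grave{}}_{2n}^{\alpha_{2n}}$, $f_A:\mathbb{R}^m\to\mathbb{C}$; $f_0$ is its body. Bosonic coordinates $x_1,\dots,x_m$, $r^2=\sum x_i^2$. Fermionic derivatives $\partial_{{x\grave{}}_j}$ commute with the $x_i$ and satisfy $\partial_{{x\grave{}}_j}({x\grave{}}_k g)=\delta_{jk}g-{x\grave{}}_k\partial_{{x\grave{}}_j}g$.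 Put $\underline{x}\grave{}^2=\sum_{j=1}^n{x\grave{}}_{2j-1}{x\grave{}}_{2j}$, $R^2=r^2-\underline{x}\grave{}^2$, and for a function $f$ on $(0,\infty)$ with enough derivatives, $f(R^2)=\sum_{j=0}^n(-1)^j\frac{\underline{x}\grave{}^{2j}}{j!}f^{(j)}(r^2)$. Write $X_i=x_i$ ($i\le m$), $X_{m+j}={x\grave{}}_j$ ($j\le 2n$), parity $[i]=0$ for $i\le m$, $[i]=1$ otherwise; $\partial_{X^i}=\partial_{x_i}$ for $i\le m$, $\partial_{X^{m+2k-1}}=2\partial_{{x\grave{}}_{2k}}$, $\partial_{X^{m+2k}}=-2\partial_{{x\grave{}}_{2k-1}}$; and $L_{ij}=X_i\partial_{X^j}-(-1)^{[i][j]}X_j\partial_{X^i}$. The Berezin integral over superspace is $\int_{\mathbb{R}^{m|2n}}g=\int_{\mathbb{R}^m}\big(\pi^{-n}\partial_{{x\grave{}}_{2n}}\cdots\partial_{{x\grave{}}_1}g\big)\,dV(\underline{x})$. *)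

(* Defs.v *)
From mathcomp Require Import all_boot all_order all_algebra.
From mathcomp Require Import all_classical all_reals all_analysis.
From mathcomp Require Import complex.
Set Implicit Arguments. Unset Strict Implicit. Unset Printing Implicit Defensive.
Import Order.TTheory GRing.Theory Num.Theory numFieldTopology.Exports numFieldNormedType.Exports.
Local Open Scope ring_scope.
Local Open Scope classical_set_scope.

Section Super.
Variable R : realType.
Local Notation C := R[i].

Definition rC (a : R) : C := Complex a 0.

Definition rsq m (x : 'rV[R]_m) : R := \sum_(i < m) x ord0 i ^+ 2.

(* Lebesgue integration on R^m, realised as iterated one-dimensional  *)
(* Lebesgue integrals (equal to the product-measure integral by        *)
(* Fubini/Tonelli for the functions considered here).                  *)
Definition vcons m (t : R) (v : 'rV[R]_m) : 'rV[R]_m.+1 :=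
  \row_(i < m.+1) match unlift ord0 i with Some j => v ord0 j | None => t end.

Fixpoint iint_pos (m : nat) : ('rV[R]_m -> \bar R) -> \bar R :=
  match m return ('rV[R]_m -> \bar R) -> \bar R with
  | 0 => fun g => g 0
  | m'.+1 => fun g =>
      (\int[@lebesgue_measure R]_(t in setT) iint_pos (fun v => g (vcons t v)))%E
  end.

Fixpoint iint (m : nat) : ('rV[R]_m -> R) -> R :=
  match m return ('rV[R]_m -> R) -> R with
  | 0 => fun g => g 0
  | m'.+1 => fun g =>
      Rintegral (@lebesgue_measure R) setT (fun t => iint (fun v => g (vcons t v)))
  end.

(* L_1(R^m) for (continuous, hence measurable) real / complex functions *)
Definition L1R m (g : 'rV[R]_m -> R) : Prop :=
  (iint_pos (fun x => (`|g x|)%:E) < +oo)%E.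
Definition L1C m (g : 'rV[R]_m -> C) : Prop :=
  L1R (fun x => complex.Re (g x)) /\ L1R (fun x => complex.Im (g x)).

Definition cint m (g : 'rV[R]_m -> C) : C :=
  Complex (iint (fun x => complex.Re (g x))) (iint (fun x => complex.Im (g x))).

(* Superfunctions f = sum_A x`_A f_A, A in {0,1}^{2n} encoded as the   *)
(* subset of 'I_(2n) where alpha = 1; x`_A is the product of the       *)
(* x`_j, j in A, in increasing order.  Indices are 0-based.           *)
Definition superfun m n := {set 'I_(2 * n)} -> 'rV[R]_m -> C.

Definition body m n (h : superfun m n) : 'rV[R]_m -> C := h finset.set0.

Definition fsign k (j : 'I_k) (A : {set 'I_k}) : C :=
  (-1) ^+ #|[set l in A | (l < j)%N]|.

Definition fmul m n (j : 'I_(2 * n)) (g : superfun m n) : superfun m n :=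
  fun A x => if j \in A then fsign j (A :\ j) * g (A :\ j) x else 0.

(* fermionic derivative d/dx`_j (left derivative: d_j (x`_k g) =
   delta_jk g - x`_k d_j g) *)
Definition fder m n (j : 'I_(2 * n)) (g : superfun m n) : superfun m n :=
  fun A x => if j \in A then 0 else fsign j A * g (j |: A) x.

Definition bmul m n (i : 'I_m) (g : superfun m n) : superfun m n :=
  fun A x => rC (x ord0 i) * g A x.

Definition pderR m (i : 'I_m) (u : 'rV[R]_m -> R) (x : 'rV[R]_m) : R :=
  'D_(delta_mx ord0 i) u x.
Definition bder m n (i : 'I_m) (g : superfun m n) : superfun m n :=
  fun A x => Complex (pderR i (fun y => complex.Re (g A y)) x)
                     (pderR i (fun y => complex.Im (g A y)) x).

Definition parity m n (k : 'I_(m + 2 * n)) : bool :=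
  if fintype.split k is inr _ then true else false.

Definition Xmul m n (k : 'I_(m + 2 * n)) (g : superfun m n) : superfun m n :=
  match fintype.split k with inl i => bmul i g | inr j => fmul j g end.

(* partner index: 0-based j even (1-based odd 2l-1) -> j+1 ; j odd -> j-1 *)
Definition partner n (j : 'I_(2 * n)) : 'I_(2 * n) :=
  insubd j (if odd j then j.-1 else j.+1).
(* d_{X^{m+2l-1}} = 2 d_{x`_{2l}},  d_{X^{m+2l}} = -2 d_{x`_{2l-1}} (1-based) *)
Definition fcoef n (j : 'I_(2 * n)) : C := if odd j then -2 else 2.

Definition Xder m n (k : 'I_(m + 2 * n)) (g : superfun m n) : superfun m n :=
  match fintype.split k with
  | inl i => bder i g
  | inr j => fun A x => fcoef j * fder (partner j) g A x
  end.

Definition Lop m n (k l : 'I_(m + 2 * n)) (g : superfun m n) : superfun m n :=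
  fun A x => Xmul k (Xder l g) A x
             - (-1) ^+ (parity k && parity l) * Xmul l (Xder k g) A x.

Definition berezin m n (g : superfun m n) : C :=
  rC (pi ^- n) * cint (foldl (fun acc j => fder j acc) g (enum 'I_(2 * n)) finset.set0).

Definition cderiv (f : R -> C) : R -> C :=
  fun t => Complex ((fun s => complex.Re (f s))^`() t)
                   ((fun s => complex.Im (f s))^`() t).
Definition cderivn (k : nat) (f : R -> C) : R -> C := iter k cderiv f.

Definition xsq m n (g : superfun m n) : superfun m n :=
  fun A x => \sum_(j < 2 * n | ~~ odd j) fmul j (fmul (partner j) g) A x.

Definition scal_sf m n (u : 'rV[R]_m -> C) : superfun m n :=
  fun A x => if A == finset.set0 then u x else 0.

Definition radial_sf m n (f : R -> C) : superfun m n :=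
  fun A x => \sum_(j < n.+1)
     rC ((-1) ^+ j / (j`!)%:R)
     * iter j (@xsq m n) (scal_sf (fun y => cderivn j f (rsq y))) A x.

End Super.

(* Main.v *)
(* The equations L_ij h = 0 for two fermionic indices kill every coefficient h_A
   whose index set A is not a union of pairs {2l-1, 2l}.  The mixed equations say
   that d_i h_B = -2 x_i h_(B + pair), so by induction on the number k of pairs
   h_A = (-1)^k f^(k)(r^2), which is h = f(R^2).  The Berezin integral is therefore
   (-1/pi)^n times the integral of f^(n)(r^2) over R^m.  Integrating over the last
   two bosonic coordinates in the plane gives pi int_a^oo f^(k+1) = - pi f^(k)(a),
   so every such step lowers both the dimension (by 2) and the order of the
   derivative (by 1); the L_1 hypothesis makes f^(k) vanish at infinity.  The
   steps are iterated until the derivatives or the dimensions are used up. *)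
Require Import Defs.
From mathcomp Require Import all_boot all_order all_algebra.
From mathcomp Require Import all_classical all_reals all_analysis.
From mathcomp Require Import measurable_realfun complex.
From mathcomp Require Import ring lra zify.
Import Order.TTheory GRing.Theory Num.Theory numFieldTopology.Exports numFieldNormedType.Exports.
Local Open Scope ring_scope.
Local Open Scope classical_set_scope.
Set Implicit Arguments.
Unset Strict Implicit.
Unset Printing Implicit Defensive.

(** * Planar integrals of radial functions *)

(** The integrals over R^m are iterated, and the inner ones are not shown to be measurable in the
    outer variables. Every reduction therefore acts on the two innermost variables, with the outer
    ones frozen into an offset b >= 0. The L_1 hypothesis is used in the same form: if |f^(k)| had
    infinite integral over the half-line, the innermost plane would contribute +oo at every offset.
    Integrability of f^(k+1) then makes f^(k) converge at infinity, and integrability of f^(k)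
    forces the limit to be 0. The body determines f only on [0, oo), and nothing is known about its
    derivatives at 0. So the proof works with functions g_k, continuous on the whole line, that
    equal (-1)^k f^(k) for s > 0 and satisfy g_k' = - g_(k+1) there for k < n. With this sign each
    planar step contributes exactly a factor pi, and g_k(0) serves as the boundary value. *)

Section planar.
Context {R : realType}.
Local Notation mu := (@lebesgue_measure R).
Local Open Scope ereal_scope.

Lemma ge0_integral_sqr (K : R -> R) : continuous K -> (forall x, 0 <= K x)%R ->
  \int[mu]_(u in `[0%R, +oo[) (K (u ^+ 2) * (2 * u))%:E =
  \int[mu]_(s in `[0%R, +oo[) (K s)%:E.
Proof.
move=> cK K0.
pose F (u : R) : R := (u ^+ 2)%R.
have dF : F^`() = (fun u => 2 * u)%R.
  by apply/funext => u; rewrite derive1E /F exp_derive expr1 -mulr_natl scaler1.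
have cF : continuous F by exact: exprn_continuous.
(* The absolute value makes the integrand nonnegative on all of R, as the exhaustion by [0, n]
   requires. *)
pose G (u : R) := (K (u ^+ 2) * (2 * `|u|))%R.
have G0 u : (0 <= G u)%R by rewrite /G mulr_ge0// mulr_ge0.
have cG' : continuous G.
  move=> u; apply: cvgM.
    by apply: continuous_comp; [exact: cF|exact: cK].
  by apply: cvgM; [exact: cvg_cst|exact: norm_continuous].
transitivity (\int[mu]_(u in `[0%R, +oo[) (G u)%:E).
  apply: eq_integral => u; rewrite inE/= in_itv/= andbT => u0.
  by rewrite /G ger0_norm.
have /cvg_lim <- // := @ge0_cvgn_integral R mu _ G0 (continuous_measurable_fun cG').
(* The right side is exhausted along the squares, so that [0, n] is mapped onto [0, n * n] and the
   two sequences agree term by term. *)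
have /cvg_lim <- // : \int[mu]_(x in `[0%R, (n * n)%:R]) (K x)%:E @[n --> \oo] -->
  \int[mu]_(s in `[0%R, +oo[) (K s)%:E.
  have H := @ge0_cvgn_integral R mu _ K0 (continuous_measurable_fun cK).
  apply: (cvg_comp (fun n => (n * n)%N) _ _ H).
  apply/cvgnyPge => N; near=> n.
  have : (N <= n)%N by near: n; exact: nbhs_infty_ge.
  by nia.
congr (limn _); apply/funext => n.
have -> : (n * n)%:R = F n%:R by rewrite /F natrM expr2.
have F0 : F 0%R = 0%R by rewrite /F expr0n.
rewrite -[in RHS]F0 (@integration_by_substitution_increasing R F K 0%R n%:R)//.
- apply: eq_integral => u; rewrite inE/= in_itv/= => /andP[u0 _].
  by rewrite fctE dF /G ger0_norm.
- move=> x y; rewrite !in_itv/= => /andP[x0 _] /andP[y0 _] xy.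
  by rewrite /F ltr_pXn2r.
- by rewrite dF => x _; apply: cvgM; [exact: cvg_cst|exact: cvg_id].
- rewrite dF; apply/cvg_ex; exists (2 * 0)%R; apply: cvg_at_right_filter.
  by apply: cvgM; [exact: cvg_cst|exact: cvg_id].
- rewrite dF; apply/cvg_ex; exists (2 * n%:R)%R; apply: cvg_at_left_filter.
  by apply: cvgM; [exact: cvg_cst|exact: cvg_id].
- split.
  + by move=> x _; exact: exprn_derivable.
  + by apply: cvg_at_right_filter; exact: cF.
  + by apply: cvg_at_left_filter; exact: cF.
- exact: continuous_subspaceT.
Unshelve. all: by end_near. Qed.

Lemma ge0_integral_scale (c : R) (K : R -> R) : (0 < c)%R -> continuous K ->
  (forall x, 0 <= K x)%R ->
  \int[mu]_(s in `[0%R, +oo[) (K (c * s))%:E =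
  c^-1%:E * \int[mu]_(s in `[0%R, +oo[) (K s)%:E.
Proof.
move=> c0 cK K0.
pose F (u : R) : R := (c * u)%R.
have cF : continuous F.
  by move=> x; apply: cvgM; [exact: cvg_cst|exact: cvg_id].
have dF : F^`() = cst c.
  by apply/funext => u; rewrite derive1Ml// derive1_id mulr1.
have F0 : F 0%R = 0%R by rewrite /F mulr0.
rewrite -[in RHS]F0 (@increasing_ge0_integration_by_substitutiony R F K 0)//.
- under [X in _ = _ * X]eq_integral do rewrite fctE dF /= mulrC EFinM.
  rewrite ge0_integralZl//.
  + by rewrite muleA -EFinM mulVf ?gt_eqF// mul1e.
  + apply/measurable_EFinP; apply: measurable_funTS.
    apply: continuous_measurable_fun => x.
    by apply: continuous_comp; [exact: cF|exact: cK].
  + by move=> x _; rewrite lee_fin K0.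
  + by rewrite lee_fin ltW.
- by move=> x y _ _ xy; rewrite /F ltr_pM2l.
- by rewrite dF => x _; exact: cvg_cst.
- by rewrite dF; apply/cvg_ex; exists c; exact: cvg_cst.
- by rewrite dF; apply/cvg_ex; exists c; exact: cvg_cst.
- split; last by apply: cvg_at_right_filter; exact: cF.
  by move=> x _; apply: derivableM.
- by apply: gt0_cvgMry => //; exact: cvg_id.
- exact: continuous_subspaceT.
Qed.

Lemma ge0_integral_scaleT (c : R) (K : R -> R) : (0 < c)%R -> continuous K ->
  (forall x, 0 <= K x)%R ->
  \int[mu]_s (K s)%:E = \int[mu]_s (K (c * s) * c)%:E.
Proof.
move=> c0 cK K0.
pose F (u : R) : R := (c * u)%R.
have cF : continuous F.
  by move=> x; apply: cvgM; [exact: cvg_cst|exact: cvg_id].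
have dF : F^`() = cst c.
  by apply/funext => u; rewrite derive1Ml// derive1_id mulr1.
rewrite (@increasing_ge0_integration_by_substitutionT R F K)//.
- by apply: eq_integral => x _; rewrite fctE dF.
- by move=> x y xy; rewrite /F ltr_pM2l.
- by rewrite dF => x; exact: cvg_cst.
- by rewrite dF; apply/cvg_ex; exists c; exact: cvg_cst.
- by rewrite dF; apply/cvg_ex; exists c; exact: cvg_cst.
- by apply: gt0_cvgMrNy => //; exact: cvg_id.
- by apply: gt0_cvgMry => //; exact: cvg_id.
Qed.


Lemma integralT_oneDsqrV : \int[mu]_w ((1 + w ^+ 2)^-1)%:E = pi%:E.
Proof.
rewrite ge0_symfun_integralT.
- rewrite (_ : [set x | _] = `[0%R, +oo[%classic); last first.
    by apply/seteqP; split => x/=; rewrite in_itv/= andbT.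
  rewrite (integral0y_oneDsqr R) -EFinM; congr EFin.
  by rewrite mulrCA divff ?mulr1.
- by move=> x; rewrite invr_ge0 addr_ge0// sqr_ge0.
- exact: continuous_oneDsqrV.
- by move=> x; rewrite /= sqrrN.
Qed.

Lemma measurable_planar (K : R -> R) : continuous K ->
  measurable_fun setT (fun z : R * R => (K (z.1 ^+ 2 + z.2 ^+ 2))%:E).
Proof.
move=> cK; apply/measurable_EFinP.
apply: measurableT_comp; first exact: continuous_measurable_fun.
by apply: measurable_funD; exact: measurable_funX.
Qed.

(** Slopes replace polar coordinates. For fixed t the substitution u = |t| w turns the integrand
    into K(t^2 (1 + w^2)) |t|. After Tonelli and evenness in t, the substitution s = t^2 followed by
    a rescaling leaves (1 + w^2)^-1 times the half-line integral, and the weight (1 + w^2)^-1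
    integrates to pi. *)
Lemma ge0_integral_planar (K : R -> R) : continuous K ->
  (forall x, 0 <= K x)%R ->
  \int[mu]_t \int[mu]_u (K (t ^+ 2 + u ^+ 2))%:E =
  pi%:E * \int[mu]_(s in `[0%R, +oo[) (K s)%:E.
Proof.
move=> cK K0.
pose f (z : R * R) := (K (z.1 ^+ 2 * (1 + z.2 ^+ 2)) * `|z.1|)%:E.
have mf : measurable_fun setT f.
  apply/measurable_EFinP; apply: measurable_funM.
    apply: measurableT_comp; first exact: continuous_measurable_fun.
    apply: measurable_funM; first exact: measurable_funX.
    by apply: measurable_funD => //; exact: measurable_funX.
  exact: measurableT_comp.
have f0 z : 0 <= f z by rewrite lee_fin mulr_ge0.
transitivity (\int[mu]_t \int[mu]_w f (t, w)).
  apply: ae_eq_integral => //.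
  - apply: (@measurable_fun_fubini_tonelli_F _ _ _ _ R mu _ (measurable_planar cK)).
    by move=> z; rewrite lee_fin.
  - exact: (@measurable_fun_fubini_tonelli_F _ _ _ _ R mu _ mf f0).
  (* At t = 0 the substitution u = |t| w degenerates; this is a null set. *)
  exists [set 0%R]; split => //; first exact: lebesgue_measure_set1.
  move=> t /= H; apply: contrapT => /eqP t0; apply: H => _.
  have nt0 : (0 < `|t|)%R by rewrite normr_gt0.
  rewrite (@ge0_integral_scaleT `|t| (fun u => K (t ^+ 2 + u ^+ 2)%R))//.
    apply: eq_integral => w _; rewrite /f/= exprMn real_normK ?num_real//.
    by rewrite mulrDr mulr1.
  move=> u; apply: continuous_comp; last exact: cK.
  by apply: cvgD; [exact: cvg_cst|exact: exprn_continuous].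
rewrite (@fubini_tonelli _ _ _ _ R mu mu f)//.
under eq_integral => w _.
  rewrite /f /= (@ge0_symfun_integralT R
    (fun t => K (t ^+ 2 * (1 + w ^+ 2)) * `|t|))%R//; last 3 first.
  - by move=> t; rewrite mulr_ge0.
  - move=> t; apply: cvgM; last exact: norm_continuous.
    apply: continuous_comp; last exact: cK.
    by apply: cvgM; [exact: exprn_continuous|exact: cvg_cst].
  - by move=> t /=; rewrite sqrrN normrN.
  over.
have w0 (w : R) : (0 < 1 + w ^+ 2)%R by rewrite ltr_pwDl// sqr_ge0.
transitivity (\int[mu]_w (((1 + w ^+ 2)^-1)%:E * \int[mu]_(s in `[0%R, +oo[) (K s)%:E)).
  apply: eq_integral => w _.
  have cKw : continuous (fun u => K ((1 + w ^+ 2) * u)%R).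
    move=> u; apply: continuous_comp; last exact: cK.
    by apply: cvgM; [exact: cvg_cst|exact: cvg_id].
  rewrite -ge0_integral_scale// -ge0_integral_sqr//.
  rewrite (_ : [set x | _] = `[0%R, +oo[%classic); last first.
    by apply/seteqP; split => x/=; rewrite in_itv/= andbT.
  rewrite -ge0_integralZl_EFin//.
  - apply: eq_integral => u; rewrite inE/= in_itv/= andbT => u0.
    by rewrite -EFinM ger0_norm// [in RHS]mulrCA [(u ^+ 2 * _)%R]mulrC.
  - by move=> u _; rewrite lee_fin mulr_ge0.
  - apply/measurable_EFinP; apply: measurable_funTS.
    apply: continuous_measurable_fun => t.
    apply: cvgM; last exact: norm_continuous.
    apply: continuous_comp; last exact: cK.
    by apply: cvgM; [exact: exprn_continuous|exact: cvg_cst].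
rewrite ge0_integralZr//.
- by rewrite integralT_oneDsqrV.
- apply/measurable_EFinP; apply: continuous_measurable_fun.
  exact: continuous_oneDsqrV.
- by move=> w _; rewrite lee_fin invr_ge0 ltW.
- by apply: integral_ge0 => s _; rewrite lee_fin.
Qed.

End planar.

Section planar_Rintegral.
Context {R : realType}.
Local Notation mu := (@lebesgue_measure R).
Local Open Scope ereal_scope.

Lemma Rintegral_planar (K : R -> R) : continuous K ->
  mu.-integrable `[0%R, +oo[ (EFin \o K) ->
  (\int[mu]_t \int[mu]_u K (t ^+ 2 + u ^+ 2) =
  pi * \int[mu]_(s in `[0%R, +oo[) K s)%R.
Proof.
move=> cK iK.
pose f (z : R * R) := (K (z.1 ^+ 2 + z.2 ^+ 2))%:E.
have mf := measurable_planar cK : measurable_fun setT f.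
have if_ : (mu \x mu).-integrable setT f.
  apply/integrable12ltyP => //.
  rewrite (@ge0_integral_planar R (fun x => `|K x|%R))//; last first.
    by move=> x; apply: cvg_norm; exact: cK.
  rewrite lte_mul_pinfty// ?lee_fin ?pi_ge0//.
  by have /integrableP[_] := iK.
have cp : continuous (K \max cst 0%R).
  by move=> x; apply: continuous_max; [exact: cK|exact: cvg_cst].
have cn : continuous ((fun x => - K x)%R \max cst 0%R).
  by move=> x; apply: continuous_max; [apply: cvgN; exact: cK|exact: cvg_cst].
(* The real-valued inner integral agrees with the extended one only where the latter is finite,
   which Fubini gives for almost every t. *)
transitivity (fine (\int[mu]_t \int[mu]_u f (t, u))).
  congr fine; apply: ae_eq_integral => //.
  - apply/measurable_EFinP; apply: measurableT_comp; first by [].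
    exact: (@measurable_fubini_F _ _ _ _ R mu mu f).
  - exact: (@measurable_fubini_F _ _ _ _ R mu mu f).
  have := @ae_integrable1 _ _ _ _ R mu mu f if_.
  apply: filterS => t it _ /=.
  by rewrite /Rintegral fineK//; exact: integrable_fin_num.
rewrite (@integral12_prod_meas1 _ _ _ _ R mu mu f)// integralE.
rewrite !fubini_tonelli1//; last 2 first.
  exact: measurable_funeneg.
  exact: measurable_funepos.
have -> : \int[mu]_x fubini_F mu f^\+ x =
    pi%:E * \int[mu]_(s in `[0%R, +oo[) (EFin \o K)^\+ s.
  transitivity (pi%:E * \int[mu]_(s in `[0%R, +oo[) ((K \max cst 0%R) s)%:E).
    rewrite -ge0_integral_planar//; last by move=> x /=; rewrite le_max lexx orbT.
    apply: eq_integral => t _; apply: eq_integral => u _.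
    by rewrite funeposE /f/= EFin_max.
  by congr (_ * _); apply: eq_integral => t _; rewrite funeposE/= EFin_max.
have -> : \int[mu]_x fubini_F mu f^\- x =
    pi%:E * \int[mu]_(s in `[0%R, +oo[) (EFin \o K)^\- s.
  transitivity (pi%:E *
      \int[mu]_(s in `[0%R, +oo[) (((fun x => - K x)%R \max cst 0%R) s)%:E).
    rewrite -ge0_integral_planar//; last by move=> x /=; rewrite le_max lexx orbT.
    apply: eq_integral => t _; apply: eq_integral => u _.
    by rewrite funenegE /f/= EFin_max.
  by congr (_ * _); apply: eq_integral => t _; rewrite funenegE/= EFin_max.
have ip := integrable_fin_num _ (integrable_funepos _ iK).
have iN := integrable_fin_num _ (integrable_funeneg _ iK).
rewrite -muleBr ?fin_num_adde_defr//; last by rewrite ip.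
rewrite fineM//; last by rewrite fin_numB ip ?iN.
by rewrite -integralE.
Qed.
End planar_Rintegral.

(** * Homogeneity of the integral without measurability *)

Section fine_scaling.
Local Open Scope ereal_scope.

(** If [p] or [q] is infinite, so is the difference on either side, even for +oo - +oo, and [fine]
    sends it to 0. *)
Lemma fine_pMB (R : realDomainType) (r : R) (p q : \bar R) :
  (0 < r)%R -> 0 <= p -> 0 <= q ->
  fine (r%:E * p - r%:E * q) = (r * fine (p - q))%R.
Proof.
move=> r0.
have ry : r%:E * +oo = +oo by rewrite gt0_muley// lte_fin.
case: p => [p _|_|]; last by rewrite leeNy_eq.
  case: q => [q _|_|]; last by rewrite leeNy_eq.
    by rewrite -!EFinM -!EFinB /= mulrBr.
  by rewrite ry /= mulr0.
case: q => [q _|_|]; last by rewrite leeNy_eq.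
  by rewrite ry /= mulr0.
by rewrite ry /= mulr0.
Qed.

End fine_scaling.

Section scaling.
Context d (T : measurableType d) (R : realType).
Variable mu : {measure set T -> \bar R}.
Local Open Scope ereal_scope.
Import HBNNSimple.

(** The integral of a nonnegative function is a supremum over simple functions below it, and [c]
    times such a function is simple and lies below [c f]. The reverse inequality is the same
    statement for [c^-1] and [c f]. *)
Lemma ge0_le_integral_scale (f : T -> \bar R) (c : R) : (0 < c)%R ->
  (forall x, 0 <= f x) -> \int[mu]_x f x <= c^-1%:E * \int[mu]_x (c%:E * f x).
Proof.
move=> c0 f0.
have cf0 x : 0 <= c%:E * f x by rewrite mule_ge0// lee_fin ltW.
rewrite (ge0_integralTE _ f0) (ge0_integralTE _ cf0).
apply: ge_ereal_sup => _ [h hf <-].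
rewrite -[leLHS]mul1e -(@mulVf _ c) ?gt_eqF// EFinM -muleA.
rewrite lee_pmul2l ?lte_fin ?invr_gt0//.
have c0' : (0 <= c)%R by exact: ltW.
have -> : c%:E * sintegral mu h = sintegral mu (scale_nnsfun h c0').
  by rewrite sintegralrM.
apply: ereal_sup_ubound => /=; exists (scale_nnsfun h c0') => //.
by move=> x; rewrite /= EFinM lee_pmul2l.
Qed.

Lemma ge0_integralTZl (f : T -> \bar R) (c : R) : (0 < c)%R ->
  (forall x, 0 <= f x) -> \int[mu]_x (c%:E * f x) = c%:E * \int[mu]_x f x.
Proof.
move=> c0 f0; apply/eqP; rewrite eq_le; apply/andP; split; last first.
  have := ge0_le_integral_scale c0 f0.
  rewrite -(@lee_pmul2l _ c%:E)//.
  by rewrite muleA -EFinM divff ?gt_eqF// mul1e.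
have cf0 x : 0 <= c%:E * f x by rewrite mule_ge0// lee_fin ltW.
have ci : (0 < c^-1)%R by rewrite invr_gt0.
have := ge0_le_integral_scale ci cf0.
rewrite invrK; under [X in _ * X]eq_integral do
  rewrite muleA -EFinM mulVf ?gt_eqF// mul1e.
by [].
Qed.

(* Neither measurability nor integrability is required: the integral is a
   difference of two suprema, both of which are homogeneous, and the junk
   value of an undefined difference is 0 on both sides. *)
Lemma RintegralTZl (f : T -> R) (c : R) :
  (\int[mu]_x (c * f x) = c * \int[mu]_x f x)%R.
Proof.
have fineBC (p q : \bar R) : 0 <= p -> 0 <= q ->
    fine (q - p) = (- fine (p - q))%R.
  case: p => [p _|_|]; last by rewrite leeNy_eq.
    case: q => [q _|_|]; last by rewrite leeNy_eq.
      by rewrite -!EFinB /= opprB.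
    by rewrite /= oppr0.
  case: q => [q _|_|]; last by rewrite leeNy_eq.
    by rewrite /= oppr0.
  by rewrite /= oppr0.
have posE (g : T -> R) : 0 <= \int[mu]_x (EFin \o g)^\+ x by exact: integral_ge0.
have negE (g : T -> R) : 0 <= \int[mu]_x (EFin \o g)^\- x by exact: integral_ge0.
have pos (r : R) (g : T -> R) : (0 < r)%R ->
    (\int[mu]_x (r * g x) = r * \int[mu]_x g x)%R.
  move=> r0; rewrite /Rintegral integralE [in RHS]integralE.
  have -> : (fun x => (r * g x)%:E) = (fun x => r%:E * (EFin \o g) x) by [].
  rewrite (ge0_funeposM (EFin \o g) (ltW r0)) (ge0_funenegM (EFin \o g) (ltW r0)).
  rewrite !ge0_integralTZl//.
  exact: fine_pMB.
have opp (g : T -> R) : (\int[mu]_x (- g x) = - \int[mu]_x g x)%R.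
  rewrite /Rintegral integralE [in RHS]integralE.
  rewrite (funeposN (EFin \o g)) (funenegN (EFin \o g)).
  exact: fineBC.
have [c0|c0|->] := ltgtP c 0%R.
- rewrite -[c]opprK; under eq_Rintegral do rewrite mulNr.
  rewrite opp pos ?oppr_gt0//. by rewrite [in RHS]mulNr.
- exact: pos.
- rewrite mul0r; under eq_Rintegral do rewrite mul0r.
  by rewrite /Rintegral integral0.
Qed.
End scaling.

(** * Fundamental theorem of calculus on a half-line *)

Section ftc_infinity.
Context {R : realType}.
Local Notation mu := (@lebesgue_measure R).
Local Open Scope ereal_scope.

(** Dominated convergence for the truncations of [H] to [0, u n], along any sequence [u] tending to
    infinity. The derivative is asked for at s > 0 only, because the profiles are functions of a
    square root; continuity covers the endpoint. *)
Lemma cvgy_FTC (G H : R -> R) : continuous G -> continuous H ->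
  (forall s : R, (0 < s)%R -> is_derive s 1%R G (H s)) ->
  mu.-integrable `[0%R, +oo[ (EFin \o H) ->
  (G x @[x --> +oo%R] --> G 0%R + \int[mu]_(s in `[0%R, +oo[) H s)%R.
Proof.
move=> cG cH dG iH; apply/cvg_pinftyP => u uy.
have uge A : \forall n \near \oo, (A <= u n)%R by move/cvgryPge : uy.
have ugt A : \forall n \near \oo, (A < u n)%R by move/cvgryPgt : uy.
have mH := continuous_measurable_fun cH.
pose f_ n (x : R) : \bar R := ((EFin \o H) \_ `[0%R, u n]) x.
have mf n : measurable_fun (`[0%R, +oo[%classic : set R) (f_ n).
  apply: (@measurable_funS _ _ _ _ setT) => //.
  apply/(measurable_restrictT (EFin \o H)) => //.
  by apply/measurable_EFinP; exact: measurable_funTS.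
have mHE : measurable_fun (`[0%R, +oo[%classic : set R) (EFin \o H).
  by apply/measurable_EFinP; exact: measurable_funTS.
have f_H : {ae mu, forall x, `[0%R, +oo[%classic x -> f_ ^~ x @ \oo --> (EFin \o H) x}.
  apply: aeW => x; rewrite /= in_itv/= andbT => x0.
  apply: cvg_near_cst; near=> n.
  rewrite /f_ patchE mem_set//= in_itv/= x0/=.
  by near: n; exact: uge.
have f_g : {ae mu, forall x n, `[0%R, +oo[%classic x ->
    `|f_ n x| <= (abse \o (EFin \o H)) x}.
  apply: aeW => x n _; rewrite /f_ patchE.
  by case: ifPn => _ /=; [exact: lexx|rewrite normr0 lee_fin normr_ge0].
have [_ _] := @dominated_convergence _ (measurableTypeR R) R mu _
  (measurable_itv _) f_ _ _ mf mHE f_H (integrable_abse iH) f_g.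
have -> : [sequence \int[mu]_(x in `[0%R, +oo[) f_ n x]_n =
    fun n => \int[mu]_(x in `[0%R, u n]) (H x)%:E.
  apply/funext => n.
  transitivity (\int[mu]_(x in `[0%R, +oo[ `&` `[0%R, u n]) (EFin \o H) x).
    by rewrite integral_mkcondr.
  rewrite setIidr//.
  by move=> x /=; rewrite !in_itv/= => /andP[->].
rewrite -[\int[mu]_(x in `[0%R, +oo[) (EFin \o H) x]fineK;
  last exact: integrable_fin_num.
move=> Hcvg.
have {}Hcvg : (G 0 + \int[mu]_(x in `[0, u n]) H x)%R @[n --> \oo] -->
    (G 0 + \int[mu]_(s in `[0, +oo[) H s)%R.
  by apply: cvgD; [exact: cvg_cst|exact: fine_cvg Hcvg].
apply: cvg_trans Hcvg.
apply: near_eq_cvg; near=> n.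
have un0 : (0 < u n)%R by near: n; exact: ugt.
rewrite /= /Rintegral (@continuous_FTC2 _ _ G)//.
- by rewrite /= addrCA subrr addr0.
- exact: continuous_subspaceT.
- split.
  + move=> x; rewrite in_itv/= => /andP[x0 _].
    by case: (dG _ x0).
  + by apply: cvg_at_right_filter; exact: cG.
  + by apply: cvg_at_left_filter; exact: cG.
- move=> x; rewrite in_itv/= => /andP[x0 _].
  by have := dG _ x0 => dGx; rewrite derive1E derive_val.
Unshelve. all: by end_near. Qed.

Lemma integrable_cvgy0 (G : R -> R) (l : R) : continuous G ->
  mu.-integrable `[0%R, +oo[ (EFin \o G) ->
  (G x @[x --> +oo%R] --> l)%R -> l = 0%R.
Proof.
move=> cG /integrableP[mG iG] Gl; apply/eqP/negPn/negP => l0.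
have nl0 : (0 < `|l|)%R by rewrite normr_gt0.
have e0 : (0 < `|l| / 2)%R by rewrite divr_gt0.
have [S [_ HS]] : \forall x \near +oo%R, (`|l| / 2 <= `|G x|)%R.
  have : (`|G x| @[x --> +oo%R] --> `|l|)%R by exact: cvg_norm.
  move/cvgrPdist_le => /(_ _ e0); apply: filterS => x.
  by rewrite ler_distl => /andP[_ +] => ?; lra.
(* The lower bound holds strictly beyond [S], hence the shift by 1; the maximum keeps the ray inside
   the half-line. *)
pose S' := Num.max (S + 1)%R 0%R.
have : \int[mu]_(x in `[S', +oo[) (cst (`|l| / 2)%:E x) < +oo.
  apply: le_lt_trans iG.
  apply: (@le_trans _ _ (\int[mu]_(x in `[S', +oo[) `|(EFin \o G) x|)).
    apply: ge0_le_integral => //.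
    - by move=> x _; rewrite lee_fin ltW.
    - apply: measurableT_comp => //; apply/measurable_EFinP/measurable_funTS.
      exact: continuous_measurable_fun.
    - move=> x; rewrite /= in_itv/= andbT => xS; rewrite lee_fin; apply: HS.
      by apply: lt_le_trans xS; rewrite lt_max ltrDl ltr01.
  apply: ge0_subset_integral => //; first exact: measurableT_comp.
  move=> x; rewrite /= !in_itv/= !andbT; apply: le_trans.
  by rewrite le_max lexx orbT.
have muS : mu `[S', +oo[ = +oo by rewrite lebesgue_measure_itv/= ltry.
by rewrite integral_cst// [X in _ * X]muS gt0_muley ?lte_fin// ltxx.
Qed.

Lemma is_derive_shift (b x : R) : is_derive x 1%R (fun u : R => b + u)%R (1%R : R).
Proof.
by have := is_deriveD (is_derive_cst b x 1%R) (is_derive_id x 1%R); rewrite add0r.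
Qed.

Lemma integral_shift (b : R) (K : R -> R) : continuous K ->
  (forall x, 0 <= K x)%R ->
  \int[mu]_(s in `[0%R, +oo[) (K (b + s)%R)%:E = \int[mu]_(s in `[b, +oo[) (K s)%:E.
Proof.
move=> cK K0.
pose F (u : R) : R := (b + u)%R.
have cF : continuous F by move=> x; apply: cvgD; [exact: cvg_cst|exact: cvg_id].
have dF (x : R) : is_derive x 1%R F 1%R by exact: is_derive_shift.
have dFE : F^`() = cst 1%R.
  by apply/funext => x; rewrite derive1E derive_val.
have F0 : F 0%R = b by rewrite /F addr0.
rewrite -[in RHS]F0 (@increasing_ge0_integration_by_substitutiony R F K 0%R)//.
- by apply: eq_integral => x _; rewrite fctE dFE /= mulr1.
- by move=> x y _ _ xy; rewrite /F ltrD2l.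
- by rewrite dFE => x _; exact: cvg_cst.
- by rewrite dFE; apply/cvg_ex; exists 1%R; exact: cvg_cst.
- by rewrite dFE; apply/cvg_ex; exists 1%R; exact: cvg_cst.
- split; last by apply: cvg_at_right_filter; exact: cF.
  by move=> x _; exact: ex_derive.
- apply/cvgryPge => A; near=> x; rewrite /F -lerBlDl; near: x.
  by apply: nbhs_pinfty_ge; exact: num_real.
- exact: continuous_subspaceT.
Unshelve. all: by end_near. Qed.

Lemma integrable_shift (b : R) (K : R -> R) : (0 <= b)%R -> continuous K ->
  mu.-integrable `[0%R, +oo[ (EFin \o K) ->
  mu.-integrable `[0%R, +oo[ (EFin \o (fun s => K (b + s)%R)).
Proof.
move=> b0 cK /integrableP[mK iK].
have cKb : continuous (fun s => K (b + s)%R).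
  move=> x; apply: continuous_comp; last exact: cK.
  by apply: cvgD; [exact: cvg_cst|exact: cvg_id].
apply/integrableP; split.
  by apply/measurable_EFinP; apply: measurable_funTS; exact: continuous_measurable_fun.
apply: le_lt_trans iK.
rewrite (@integral_shift b (fun x => `|K x|%R))//; last first.
  by move=> x; apply: cvg_norm; exact: cK.
apply: ge0_subset_integral => //.
  apply/measurable_EFinP; apply: measurable_funTS; apply: continuous_measurable_fun => x.
  by apply: cvg_norm; exact: cK.
by move=> x; rewrite /= !in_itv/= !andbT; exact: le_trans.
Qed.

Lemma Rintegral_FTCy (G H : R -> R) (b : R) : (0 <= b)%R ->
  continuous G -> continuous H ->
  (forall s : R, (0 < s)%R -> is_derive s 1%R G (H s)) ->
  mu.-integrable `[0%R, +oo[ (EFin \o G) ->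
  mu.-integrable `[0%R, +oo[ (EFin \o H) ->
  (\int[mu]_(s in `[0%R, +oo[) H (b + s) = - G b)%R.
Proof.
move=> b0 cG cH dG iG iH.
have cb (K : R -> R) : continuous K -> continuous (fun s => K (b + s)%R).
  move=> cK x; apply: continuous_comp; last exact: cK.
  by apply: cvgD; [exact: cvg_cst|exact: cvg_id].
have := @cvgy_FTC (fun s => G (b + s)%R) (fun s => H (b + s)%R)
  (cb _ cG) (cb _ cH) _ (integrable_shift b0 cH iH).
move=> /(_ _)/(integrable_cvgy0 (cb _ cG) (integrable_shift b0 cG iG)).
rewrite addr0 => E; apply/eqP; rewrite -addr_eq0 addrC; apply/eqP/E.
move=> s s0.
have bs0 : (0 < b + s)%R by rewrite ltr_wpDl.
have dG' := dG _ bs0.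
have dF := is_derive_shift b s.
by have := is_derive1_comp dG' dF; rewrite mulr1.
Qed.
End ftc_infinity.

(** * Iterated integrals of radial functions *)

Section radial.
Context {R : realType}.
Local Notation mu := (@lebesgue_measure R).

(** The iterated integral of F(a + t_1^2 + ... + t_m^2). The offset [a] collects the squares of the
    variables further out, which makes inductions on the dimension go through. *)
Fixpoint rint (m : nat) (F : R -> R) (a : R) : R :=
  if m is m'.+1 then \int[mu]_t rint m' F (a + t ^+ 2) else F a.

Fixpoint erint (m : nat) (F : R -> \bar R) (a : R) : \bar R :=
  if m is m'.+1 then (\int[mu]_t erint m' F (a + t ^+ 2)%R)%E else F a.

Lemma rsq0 : rsq (0 : 'rV[R]_0) = 0.
Proof. by rewrite /rsq big_ord0. Qed.

Lemma rsq_vcons m t (v : 'rV[R]_m) : rsq (vcons t v) = t ^+ 2 + rsq v.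
Proof.
rewrite /rsq big_ord_recl /vcons mxE unlift_none; congr (_ + _).
by apply: eq_bigr => i _; rewrite mxE liftK.
Qed.

Lemma iint_rsq m (F : R -> R) (a : R) :
  iint (fun x : 'rV[R]_m => F (a + rsq x)) = rint m F a.
Proof.
elim: m a => [|m IH] a /=; first by rewrite rsq0 addr0.
apply: eq_Rintegral => t _; rewrite -IH; congr iint.
by apply/funext => v; rewrite rsq_vcons addrA.
Qed.

Lemma iint_pos_rsq m (F : R -> \bar R) (a : R) :
  iint_pos (fun x : 'rV[R]_m => F (a + rsq x)) = erint m F a.
Proof.
elim: m a => [|m IH] a /=; first by rewrite rsq0 addr0.
apply: eq_integral => t _; rewrite -IH; congr iint_pos.
by apply/funext => v; rewrite rsq_vcons addrA.
Qed.

Lemma rintD p q (F : R -> R) a : rint (p + q) F a = rint p (rint q F) a.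
Proof.
by elim: p a => [|p IH] a //=; apply: eq_Rintegral => t _; exact: IH.
Qed.

Lemma erintD p q (F : R -> \bar R) a : erint (p + q) F a = erint p (erint q F) a.
Proof.
by elim: p a => [|p IH] a //=; apply: eq_integral => t _; exact: IH.
Qed.

Lemma eq_rint m (F G : R -> R) a : (forall b, 0 <= b -> F b = G b) ->
  0 <= a -> rint m F a = rint m G a.
Proof.
move=> FG; elim: m a => [|m IH] a a0 /=; first exact: FG.
by apply: eq_Rintegral => t _; rewrite IH// addr_ge0// sqr_ge0.
Qed.

Lemma rintZl m (F : R -> R) c a : rint m (fun s => c * F s) a = c * rint m F a.
Proof.
elim: m a => [|m IH] a //=.
by rewrite -RintegralTZl; apply: eq_Rintegral => t _; exact: IH.
Qed.

Lemma erinty m (F : R -> \bar R) a : (forall b, 0 <= b -> F b = +oo%E) ->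
  0 <= a -> erint m F a = +oo%E.
Proof.
move=> Fy; elim: m a => [|m IH] a a0 /=; first exact: Fy.
have muT : mu [set: R] = +oo%E by rewrite -set_itvNyy lebesgue_measure_itv.
transitivity (\int[mu]_(t in setT) cst (+oo : \bar R) t)%E.
  by apply: eq_integral => t _; rewrite IH// addr_ge0// sqr_ge0.
by rewrite integral_cst// [X in (_ * X)%E]muT.
Qed.

Lemma continuous_shift (b : R) (K : R -> R) : continuous K ->
  continuous (fun s => K (b + s)).
Proof.
move=> cK x; apply: continuous_comp; last exact: cK.
by apply: cvgD; [exact: cvg_cst|exact: cvg_id].
Qed.

Lemma erint2 (K : R -> R) (b : R) : continuous K -> (forall x, 0 <= K x) ->
  erint 2 (EFin \o K) b =
  (pi%:E * \int[mu]_(s in `[b, +oo[) (K s)%:E)%E.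
Proof.
move=> cK K0; rewrite -integral_shift// -ge0_integral_planar//; last first.
  exact: continuous_shift.
by apply: eq_integral => t _ /=; apply: eq_integral => u _; rewrite addrA.
Qed.

Lemma rint2 (K : R -> R) (b : R) : 0 <= b -> continuous K ->
  mu.-integrable `[0, +oo[ (EFin \o K) ->
  rint 2 K b = pi * \int[mu]_(s in `[0, +oo[) K (b + s).
Proof.
move=> b0 cK iK; rewrite -Rintegral_planar//; last 2 first.
- exact: continuous_shift.
- exact: integrable_shift.
by apply: eq_Rintegral => t _ /=; apply: eq_Rintegral => u _; rewrite addrA.
Qed.

(** Contraposition. [G] is bounded on [0, b], so an infinite integral of |G| over [0, oo) stays
    infinite over [b, oo) for every b >= 0. By [erint2] the innermost plane then gives +oo at each
    offset, and the outer integrals preserve this. *)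
Lemma erint_integrable p (G : R -> R) : continuous G ->
  (erint (p + 2) (fun s => `|G s|%:E) 0 < +oo)%E ->
  mu.-integrable `[0, +oo[ (EFin \o G).
Proof.
move=> cG fin.
have cN : continuous (fun s => `|G s|) by move=> x; apply: cvg_norm; exact: cG.
have mN (D : set R) : measurable D -> measurable_fun D (fun s => `|G s|%:E).
  move=> mD; apply/measurable_EFinP; apply: measurable_funTS.
  exact: continuous_measurable_fun.
apply/integrableP; split.
  by apply/measurable_EFinP; apply: measurable_funTS; exact: continuous_measurable_fun.
rewrite ltNge leye_eq; apply/negP => /eqP Ey.
suff : erint (p + 2) (fun s => `|G s|%:E) 0 = +oo%E by move=> Ey'; rewrite Ey' ltxx in fin.
rewrite erintD; apply: erinty => // b b0.
rewrite (@erint2 (fun s => `|G s|))//.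
suff -> : (\int[mu]_(s in `[b, +oo[) `|G s|%:E = +oo)%E.
  by rewrite gt0_muley// lte_fin pi_gt0.
apply/eqP; rewrite -leye_eq leNgt; apply/negP => lty.
have : (\int[mu]_(x in `[0%R, +oo[) `|(EFin \o G) x| < +oo)%E.
  rewrite (@itv_bndbnd_setU _ _ (BLeft 0) (BLeft b) +oo%O)//.
  rewrite ge0_integral_setU//=; last 2 first.
  - by apply: mN; exact: measurableU.
  - apply/disj_setPS => x [] /=; rewrite !in_itv/= andbT => /andP[_ xb].
    by rewrite leNgt xb.
  rewrite lte_add_pinfty//.
  have /integrableP[_] : mu.-integrable `[0, b] (EFin \o G).
    apply: continuous_compact_integrable; first exact: segment_compact.
    exact: continuous_subspaceT.
  apply: le_lt_trans; apply: ge0_subset_integral => //=; first exact: mN.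
  by move=> x; rewrite /= !in_itv/= => /andP[-> /ltW].
by rewrite Ey ltxx.
Qed.


Lemma rint_reduce p (G H : R -> R) (a : R) : 0 <= a ->
  continuous G -> continuous H ->
  (forall s : R, 0 < s -> is_derive s 1 G (- H s)) ->
  mu.-integrable `[0, +oo[ (EFin \o G) ->
  mu.-integrable `[0, +oo[ (EFin \o H) ->
  rint (p + 2) H a = pi * rint p G a.
Proof.
move=> a0 cG cH dG iG iH; rewrite rintD -rintZl; apply: eq_rint => // b b0.
rewrite rint2//; congr (_ * _).
have cH' : continuous (fun s => - H s) by move=> x; apply: cvgN; exact: cH.
have iH' : mu.-integrable `[0, +oo[ (EFin \o (fun s => - H s)).
  have -> : EFin \o (fun s => - H s) = (\- (EFin \o H))%E by [].
  exact: integrableN.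
have := Rintegral_FTCy b0 cG cH' dG iG iH'.
under eq_Rintegral do rewrite -mulN1r.
rewrite RintegralZl//; last exact: integrable_shift.
by rewrite mulN1r => /oppr_inj.
Qed.

Lemma rint_iter (g : nat -> R -> R) n p q : (q <= n)%N ->
  (forall k, continuous (g k)) ->
  (forall k (s : R), (k < n)%N -> 0 < s -> is_derive s 1 (g k) (- g k.+1 s)) ->
  (forall k, (k <= n)%N -> (erint (p + 2 * q) (fun s => `|g k s|%:E) 0 < +oo)%E) ->
  rint (p + 2 * q) (g n) 0 = pi ^+ q * rint p (g (n - q)%N) 0.
Proof.
move=> qn cg dg ig.
(* For q = 0 there may be no plane from which to extract integrability, but the claim is then
   trivial. For q > 0 integrability of every [g k] is extracted once, in the full dimension, before
   [p] starts to vary. *)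
case: q => [|q] in qn ig *; first by rewrite muln0 addn0 subn0 expr0 mul1r.
have {}ig k : (k <= n)%N -> mu.-integrable `[0, +oo[ (EFin \o g k).
  move=> kn; apply: (@erint_integrable (p + 2 * q)) => //.
  by rewrite -addnA -mulnSr; exact: ig.
elim: q.+1 p qn => [|{}q IH] p qn.
  by rewrite muln0 addn0 subn0 expr0 mul1r.
rewrite mulnSr [(2 * q + 2)%N]addnC addnA IH; last exact: ltnW.
rewrite exprSr -mulrA; congr (_ * _).
apply: rint_reduce => //.
- move=> s s0; have -> : (n - q = (n - q.+1).+1)%N by rewrite subnSK.
  by apply: dg => //; rewrite -subn_gt0 subKn.
- by apply: ig; exact: leq_subr.
- by apply: ig; exact: leq_subr.
Qed.

(** The positive and negative parts are even and are doubled separately; [fine_pMB] then covers the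
    case where one or both have infinite integral. *)
Lemma ge0_symfun_Rintegral (g : R -> R) : continuous g ->
  \int[mu]_t g (t ^+ 2) = 2 * \int[mu]_(t in `]0, +oo[) g (t ^+ 2).
Proof.
move=> cg.
have cg2 : continuous (fun t : R => g (t ^+ 2)).
  by move=> x; apply: continuous_comp; [exact: exprn_continuous|exact: cg].
have cmax (k : R -> R) : continuous k -> continuous (k \max cst 0).
  by move=> ck x; apply: continuous_max; [exact: ck|exact: cvg_cst].
have half (k : R -> R) : continuous k -> (forall x, 0 <= k x) -> k =1 k \o -%R ->
    (\int[mu]_t (k t)%:E = 2%:E * \int[mu]_(t in `]0%R, +oo[) (k t)%:E)%E.
  move=> ck k0 evk; rewrite ge0_symfun_integralT// integral_itv_obnd_cbnd.
    congr (_ * integral _ _ _)%E.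
    by apply/seteqP; split => x/=; rewrite in_itv/= andbT.
  by apply/measurable_EFinP; apply: measurable_funTS; exact: continuous_measurable_fun.
pose k (t : R) := g (t ^+ 2).
have ckN : continuous (fun t : R => - k t) by move=> x; apply: cvgN; exact: cg2.
have Ep : (EFin \o k)^\+%E = EFin \o (k \max cst 0).
  by apply/funext => x; rewrite funeposE /= EFin_max.
have En : (EFin \o k)^\-%E = EFin \o ((fun t => - k t) \max cst 0).
  by apply/funext => x; rewrite funenegE /= EFin_max.
rewrite /Rintegral integralE [in RHS]integralE Ep En.
rewrite !half //.
- by rewrite fine_pMB//; apply: integral_ge0 => x _; rewrite lee_fin le_max lexx orbT.
- exact: cmax.
- by move=> x; rewrite le_max lexx orbT.
- by move=> x /=; rewrite /k sqrrN.
- exact: cmax.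
- by move=> x; rewrite le_max lexx orbT.
- by move=> x /=; rewrite /k sqrrN.
Qed.

End radial.

(** * Pairs of Grassmann generators *)

Section pairs.
Variable n : nat.
Implicit Types (j l : 'I_(2 * n)) (A B : {set 'I_(2 * n)}).

(** The default of [insubd] never occurs: an even j < 2n satisfies j + 1 < 2n. *)
Lemma val_partner j : partner j = (if odd j then j.-1 else j.+1) :> nat.
Proof.
rewrite /partner val_insubd; case: ifP => // /negbT.
by have := ltn_ord j; case: ifPn; lia.
Qed.

Lemma odd_partner j : odd (partner j) = ~~ odd j.
Proof. by rewrite val_partner; case: ifPn; lia. Qed.

Lemma partnerK : involutive (@partner n).
Proof.
move=> j; apply: val_inj; rewrite /= val_partner odd_partner val_partner.
by case: (boolP (odd j)) => oj /=; move: oj; case: (nat_of_ord j).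
Qed.

Lemma partner_neq j : partner j != j.
Proof. by apply/eqP => /(congr1 (fun l : 'I_(2 * n) => odd l)); rewrite odd_partner; case: odd. Qed.

Definition paired A := [forall j in A, partner j \in A].
Definition npairs A := #|[set j in A | ~~ odd j]|.

Lemma pairedP A : reflect (forall j, (partner j \in A) = (j \in A)) (paired A).
Proof.
apply: (iffP forall_inP) => [H j|H j]; last by rewrite H.
by apply/idP/idP => [/H|/H//]; rewrite partnerK.
Qed.

Lemma card_paired A : paired A -> #|A| = (npairs A).*2.
Proof.
move=> /pairedP pA; rewrite -(cardsID [set j : 'I_(2 * n) | ~~ odd j] A).
rewrite -addnn /npairs; congr (_ + _)%N.
  by apply: eq_card => j; rewrite !inE.
rewrite -[RHS](card_imset _ (inv_inj partnerK)); apply: eq_card => j.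
rewrite !inE negbK; apply/idP/imsetP => [/andP[oj jA]|[l]].
  by exists (partner j); rewrite ?partnerK// !inE pA odd_partner oj jA.
by rewrite !inE => /andP[lA ol] ->; rewrite pA odd_partner ol lA.
Qed.

Definition addpair j A := partner j |: (j |: A).
Definition delpair j A := A :\ j :\ partner j.

Lemma paired_addpair j A : paired A -> paired (addpair j A).
Proof.
move=> /pairedP pA; apply/pairedP => l; rewrite !inE pA.
by rewrite (inj_eq (inv_inj partnerK)) (inv_eq partnerK) orbCA.
Qed.

Lemma paired_delpair j A : j \in A -> partner j \in A ->
  paired (delpair j A) = paired A.
Proof.
move=> jA pjA; apply/pairedP/pairedP => pA l; move: (pA l);
  rewrite !inE (inj_eq (inv_inj partnerK)) (inv_eq partnerK).
  case: eqP => [->|_] /=; first by rewrite jA pjA.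
  case: eqP => [->|_] //=; by rewrite partnerK jA pjA.
by move=> ->; rewrite andbCA.
Qed.

Lemma delpairK j A : j \in A -> partner j \in A -> addpair j (delpair j A) = A.
Proof.
move=> jA pjA; apply/setP => l; rewrite !inE.
have [->|_] /= := eqVneq l (partner j); first by rewrite pjA.
by have [->|_] /= := eqVneq l j; first by rewrite jA.
Qed.

Lemma npairs_addpair j A : ~~ odd j -> j \notin A ->
  npairs (addpair j A) = (npairs A).+1.
Proof.
move=> oj jA; rewrite /npairs.
have -> : [set l in addpair j A | ~~ odd l] = j |: [set l in A | ~~ odd l].
  apply/setP => l; rewrite !inE; have [->|lj] /= := eqVneq l (partner j).
    by rewrite odd_partner oj /= andbF orbF (negbTE (partner_neq j)).
  by have [->|] := eqVneq l j.
by rewrite cardsU1 !inE negb_and jA.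
Qed.

Lemma npairs_delpair j A : ~~ odd j -> j \in A -> partner j \in A ->
  npairs A = (npairs (delpair j A)).+1.
Proof.
move=> oj jA pjA; rewrite -[in LHS](delpairK jA pjA) npairs_addpair//.
by rewrite !inE eqxx andbF.
Qed.

Lemma paired0 : paired finset.set0.
Proof. by apply/pairedP => j; rewrite !inE. Qed.

Lemma npairs0 : npairs finset.set0 = 0%N.
Proof. by apply: eq_card0 => j; rewrite !inE. Qed.

Lemma paired_npairs0 A : paired A -> npairs A = 0%N -> A = finset.set0.
Proof. by move=> /card_paired + A0; rewrite A0 => /cards0_eq. Qed.

Lemma npairs_pos A : (0 < npairs A)%N -> exists2 j : 'I_(2 * n), ~~ odd j & j \in A.
Proof. by rewrite card_gt0 => /set0Pn[j]; rewrite !inE => /andP[jA oj]; exists j. Qed.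

(** A canonical index set with [k] pairs: its coefficient defines [profile k], and for k = n it is
    the full set, whose coefficient the Berezin integral selects. *)
Definition firstpairs k : {set 'I_(2 * n)} := [set l : 'I_(2 * n) | (l < 2 * k)%N].

Lemma firstpairsS k (kn : (2 * k < 2 * n)%N) :
  firstpairs k.+1 = addpair (Ordinal kn) (firstpairs k).
Proof.
apply/setP => l; rewrite !inE -!val_eqE /= val_partner /=.
have -> : odd (2 * k) = false by lia.
by lia.
Qed.

Lemma firstpairs_notin k (kn : (2 * k < 2 * n)%N) :
  (Ordinal kn \notin firstpairs k) /\ (partner (Ordinal kn) \notin firstpairs k).
Proof.
rewrite !inE val_partner /=; have -> : odd (2 * k) = false by lia.
by split; lia.
Qed.

Lemma firstpairs0 : firstpairs 0 = finset.set0.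
Proof. by apply/setP => l; rewrite !inE muln0. Qed.

Lemma firstpairsT : firstpairs n = [set: 'I_(2 * n)]%SET.
Proof. by apply/setP => l; rewrite !inE ltn_ord. Qed.

Lemma firstpairsP k : (k <= n)%N ->
  paired (firstpairs k) /\ npairs (firstpairs k) = k.
Proof.
elim: k => [_|k IH kn]; first by rewrite firstpairs0 paired0 npairs0.
have kn' : (2 * k < 2 * n)%N by lia.
have [pk nk] := IH (ltnW kn); have [jN pN] := firstpairs_notin kn'.
rewrite (firstpairsS kn') npairs_addpair ?nk//=; last by lia.
by split => //; exact: paired_addpair.
Qed.

Lemma npairs_le A : (npairs A <= n)%N.
Proof.
have [_ nT] := firstpairsP (leqnn n); rewrite -[leqRHS]nT.
by apply: subset_leq_card; apply/fintype.subsetP => j; rewrite firstpairsT !inE => /andP[].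
Qed.
End pairs.

(** * Signs from reordering the generators *)

Section fermionic_signs.
Variables (R : realType) (n : nat).
Local Notation C := R[i].
Implicit Types (j l : 'I_(2 * n)) (A B : {set 'I_(2 * n)}).

Lemma fsign_neq0 k (j : 'I_k) (A : {set 'I_k}) : fsign R j A != 0.
Proof. by rewrite /fsign expf_neq0// oppr_eq0 oner_eq0. Qed.

(** The elements of [A] below [j] form whole pairs: a pair of consecutive indices split by [j] would
    contain [j], which is not in [A]. Their number is therefore even. *)
Lemma fsign_paired j A : paired A -> j \notin A -> fsign R j A = 1.
Proof.
move=> /pairedP pA jA; rewrite /fsign -signr_odd.
have pS : paired [set l in A | (l < j)%N].
  apply/pairedP => l; rewrite !inE pA; have [lA|//] := boolP (l \in A) => /=.
  have lj : (l : nat) != j by apply: contraNneq jA => /val_inj <-.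
  have plj : (partner l : nat) != j by apply: contraNneq jA => /val_inj <-; rewrite pA.
  move: lj plj; rewrite val_partner; have [ol|ol] := boolP (odd l); lia.
by rewrite (card_paired pS) odd_double.
Qed.

Lemma fsign_partner j A : ~~ odd j -> paired A -> j \notin A ->
  fsign R (partner j) (j |: A) = -1.
Proof.
move=> oj pA jA.
have pjA : partner j \notin A by move/pairedP : (pA) => ->.
have := fsign_paired pA pjA; rewrite /fsign => E.
have -> : [set l in j |: A | (l < partner j)%N] =
    j |: [set l in A | (l < partner j)%N].
  apply/setP => l; rewrite !inE; have [->|//] := eqVneq l j.
  by rewrite val_partner (negbTE oj) ltnSn.
by rewrite cardsU1 !inE (negbTE jA) /= exprS E mulr1.
Qed.

End fermionic_signs.

(** * Superfunctions *)

Section superfunctions.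
Variables (R : realType) (m n : nat).
Local Notation C := R[i].
Implicit Types (i : 'I_m) (j : 'I_(2 * n)) (A B : {set 'I_(2 * n)}).
Implicit Types (g h : superfun R m n) (x : 'rV[R]_m).

Lemma rCE (a : R) : rC a = real_complex R a.
Proof. by []. Qed.

Lemma XmulL i g : Xmul (lshift (2 * n) i) g = bmul i g.
Proof. by rewrite /Xmul (unsplitK (inl i)). Qed.

Lemma XmulR j g : Xmul (rshift m j) g = fmul j g.
Proof. by rewrite /Xmul (unsplitK (inr j)). Qed.

Lemma XderL i g : Xder (lshift (2 * n) i) g = bder i g.
Proof. by rewrite /Xder (unsplitK (inl i)). Qed.

Lemma XderR j g :
  Xder (rshift m j) g = fun A x => fcoef R j * fder (partner j) g A x.
Proof. by rewrite /Xder (unsplitK (inr j)). Qed.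

Lemma parityL i : parity (lshift (2 * n) i) = false.
Proof. by rewrite /parity (unsplitK (inl i)). Qed.

Lemma parityR j : parity (rshift m j) = true.
Proof. by rewrite /parity (unsplitK (inr j)). Qed.

(** The diagonal operators suffice: for odd [j] the two terms of L_jj add up to 2 X_j d_(X^j), which
    trades the generator [partner j] for [j]. If [A] contains q but not j = [partner q], the
    coefficient of L_jj h at [A] with q replaced by j is a nonzero multiple of h_A. *)
Lemma Lop_unpaired h :
  (forall j A x, Lop (rshift m j) (rshift m j) h A x = 0) ->
  forall A x, ~~ paired A -> h A x = 0.
Proof.
move=> Lh A x /forall_inPn[q qA jA].
set j := partner q in jA.
have pj : partner j = q by rewrite /j partnerK.
have nqj : q != j by rewrite -pj partner_neq.
have := Lh j (j |: A :\ q) x.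
rewrite /Lop XmulR XderR parityR /= expr1 mulN1r opprK /fmul /fder pj setU11.
rewrite setU1K; last by rewrite !inE (negbTE jA) andbF.
rewrite !inE eqxx /= finset.setD1K// => /eqP.
rewrite -mulr2n mulrn_eq0 /= !mulf_eq0 !(negbTE (fsign_neq0 _ _ _)) /=.
rewrite /fcoef; case: (odd j); rewrite ?oppr_eq0 pnatr_eq0 /= => /eqP //.
Qed.

Lemma Lop_mixed h i j B x : Lop (lshift (2 * n) i) (rshift m j) h (j |: B) x = 0 ->
  ~~ odd j -> paired B -> j \notin B ->
  bder i h B x = rC (- 2 * x ord0 i) * h (addpair j B) x.
Proof.
move=> + oj pB jB.
have pjB : partner j \notin B by move/pairedP : (pB) => ->.
rewrite /Lop XmulL XmulR XderL XderR parityL /= expr0 mul1r /bmul /fmul /fder.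
rewrite setU11 setU1K// !inE (negbTE (partner_neq j)) (negbTE pjB) /=.
rewrite fsign_partner// fsign_paired// /fcoef (negbTE oj) mul1r => /eqP.
rewrite subr_eq0 => /eqP <-.
rewrite mulN1r mulrN mulrN -/(addpair j B).
have -> : rC (- 2 * x ord0 i) = - (2 * rC (x ord0 i)).
  by rewrite !rCE rmorphM rmorphN rmorph_nat mulNr.
by rewrite mulNr; congr (- _); rewrite mulrCA mulrA.
Qed.

Lemma xsqE g A x :
  xsq g A x = \sum_(j < 2 * n | ~~ odd j)
    (if (j \in A) && (partner j \in A) then g (delpair j A) x else 0).
Proof.
apply: eq_bigr => j oj; rewrite /fmul.
case: (boolP (j \in A)) => //= jA; rewrite !inE (partner_neq j) /=.
case: ifP => pjA; last by rewrite mulr0.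
rewrite mulrA /delpair.
(* Since [partner j] is j + 1, both signs count the same elements, and their product is 1. *)
suff -> : fsign R j (A :\ j) = fsign R (partner j) (A :\ j :\ partner j).
  by rewrite /fsign -exprD addnn -mul2n exprM sqrrN expr1n expr1n mul1r.
rewrite /fsign; congr (_ ^+ _); apply: eq_card => l.
rewrite !inE -!val_eqE /= !val_partner (negbTE oj).
by case: (l \in A); rewrite ?andbF ?andbT //; lia.
Qed.

(** The factorial counts the orders in which the pairs of [A] can be removed; it cancels the 1/j! of
    the Taylor expansion. *)
Lemma iter_xsq k (u : 'rV[R]_m -> C) A x :
  iter k (@xsq R m n) (scal_sf u) A x =
  if paired A && (npairs A == k) then k`!%:R * u x else 0.
Proof.
elim: k A => [|k IH] A /=.
  rewrite /scal_sf fact0 mul1r; congr (if _ then _ else _).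
  apply/eqP/andP => [->|[pA /eqP nA]]; first by rewrite paired0 npairs0.
  exact: paired_npairs0.
rewrite xsqE; case: (boolP (paired A)) => /= pA; last first.
  apply: big1 => j oj; case: ifP => // /andP[jA pjA].
  by rewrite IH paired_delpair// (negbTE pA).
transitivity (\sum_(j < 2 * n | ~~ odd j && (j \in A))
    (if npairs A == k.+1 then k`!%:R * u x else 0)).
  rewrite [RHS]big_mkcondr; apply: eq_bigr => j oj.
  move/pairedP : (pA) => ->; rewrite andbb; case: ifP => // jA.
  have pjA : partner j \in A by move/pairedP : (pA) => ->.
  by rewrite IH paired_delpair// pA (npairs_delpair oj jA pjA) eqSS.
rewrite sumr_const.
have -> : #|[pred j : 'I_(2 * n) | ~~ odd j & j \in A]| = npairs A.
  by apply: eq_card => j; rewrite !inE andbC.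
case: eqP => [->|_]; last by rewrite mul0rn.
by rewrite factS natrM -mulrA [in RHS]mulr_natl.
Qed.

Lemma radial_sfE (f : R -> C) A x :
  radial_sf f A x =
  if paired A then (-1) ^+ npairs A * cderivn (npairs A) f (rsq x) else 0.
Proof.
rewrite /radial_sf; under eq_bigr do rewrite iter_xsq.
case: (boolP (paired A)) => /= pA; last by apply: big1 => j _; rewrite mulr0.
have kn : (npairs A < n.+1)%N by rewrite ltnS npairs_le.
rewrite (bigD1 (Ordinal kn))//= eqxx big1 ?addr0; last first.
  move=> j jk; rewrite ifF ?mulr0//; apply: contraNF jk => /eqP jk.
  by apply/eqP/val_inj.
rewrite mulrA; congr (_ * _).
rewrite !rCE -(rmorph_nat (real_complex R)) -rmorphM divfK.
  by rewrite rmorphXn rmorphN1.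
by rewrite pnatr_eq0 -lt0n fact_gt0.
Qed.

(** Differentiating in increasing order produces no sign: the coefficient read off at stage k
    involves only generators above k. *)
Lemma foldl_fder k g x : (k <= 2 * n)%N ->
  foldl (fun acc j => fder j acc) g (take k (enum 'I_(2 * n)))
    [set l : 'I_(2 * n) | (k <= l)%N]%SET x = g [set: 'I_(2 * n)]%SET x.
Proof.
elim: k => [_|k IH kn]; first by rewrite take0 /=; congr (g _ x); apply/setP => l; rewrite !inE.
have j0 := Ordinal kn.
rewrite (take_nth j0) ?size_enum_ord// -cats1 foldl_cat /= {1}/fder.
have -> : nth j0 (enum 'I_(2 * n)) k = Ordinal kn.
  by apply: val_inj; rewrite /= nth_enum_ord.
rewrite inE /= ltnn.
have -> : fsign R (Ordinal kn) [set l : 'I_(2 * n) | (k < l)%N]%SET = 1.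
  rewrite /fsign eq_card0// => l; rewrite !inE /=.
  by apply/negbTE/negP => /andP[kl lk]; have := ltn_trans kl lk; rewrite ltnn.
rewrite mul1r -IH ?(ltnW kn)//; congr (foldl _ _ _ _ x).
by apply/setP => l; rewrite !inE -val_eqE /= [in RHS]leq_eqVlt eq_sym.
Qed.

Lemma berezinE g : berezin g = rC (pi ^- n) * cint (g [set: 'I_(2 * n)]%SET).
Proof.
rewrite /berezin; congr (_ * cint _); apply/funext => x.
rewrite -(@foldl_fder (2 * n) g x)// take_oversize ?size_enum_ord//.
congr (foldl _ _ _ _ x).
by apply/setP => l; rewrite !inE leqNgt ltn_ord.
Qed.
End superfunctions.

(** * The radial profile *)

Section lines.
Variable R : realType.

Lemma is_derive_line m (F : 'rV[R]_m -> R) (x v : 'rV[R]_m) (t : R) :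
  differentiable F (t *: v + x) ->
  is_derive t 1 (fun s : R => F (s *: v + x)) ('D_v F (t *: v + x)).
Proof.
move=> dF; have dFv : derivable F (t *: v + x) v by exact: diff_derivable.
have E : (fun h : R => h^-1 *:
      (((fun s : R => F (s *: v + x)) \o shift t) (h *: 1) - F (t *: v + x))) =
    (fun h : R => h^-1 *: ((F \o shift (t *: v + x)) (h *: v) - F (t *: v + x))).
  apply/funext => h /=; congr (_ *: (F _ - _)).
  by rewrite /GRing.scale/= mulr1 -/(GRing.scale _ _) scalerDl addrA.
apply: DeriveDef.
  by rewrite /derivable E.
by rewrite /derive E.
Qed.

Lemma rsq_scale m (t : R) (i : 'I_m) : rsq (t *: delta_mx ord0 i : 'rV[R]_m) = t ^+ 2.
Proof.
rewrite /rsq (bigD1 i)//= !mxE !eqxx mulr1 big1 ?addr0// => j ji.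
by rewrite !mxE eqxx (negbTE ji) mulr0 expr0n.
Qed.

Lemma rsq_line m (t : R) (i : 'I_m) (x : 'rV[R]_m) :
  rsq (t *: delta_mx ord0 i + x) = rsq x + 2 * x ord0 i * t + t ^+ 2.
Proof.
rewrite /rsq (bigD1 i)//= [in RHS](bigD1 i)//= !mxE !eqxx mulr1.
rewrite (eq_bigr (fun j => x ord0 j ^+ 2)); first by ring.
by move=> j ji; rewrite !mxE eqxx (negbTE ji) mulr0 add0r.
Qed.

Lemma rsq_ge0 m (x : 'rV[R]_m) : 0 <= rsq x.
Proof. by apply: sumr_ge0 => i _; exact: sqr_ge0. Qed.

Lemma rsq_gt0 m (x : 'rV[R]_m) : x != 0 -> 0 < rsq x.
Proof.
move=> /rV0Pn[i xi]; rewrite /rsq (bigD1 i)//= ltr_pwDl//.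
  by rewrite exprn_even_gt0.
by apply: sumr_ge0 => j _; exact: sqr_ge0.
Qed.
End lines.

Section radial_structure.
Variables (R : realType) (m n : nat).
Implicit Types (j : 'I_(2 * n)) (A B : {set 'I_(2 * n)}).
Variable u : {set 'I_(2 * n)} -> 'rV[R]_m.+1 -> R.
Hypothesis du : forall A x, differentiable (u A) x.
Hypothesis pu : forall i j B x, ~~ odd j -> paired B -> j \notin B ->
  pderR i (u B) x = - 2 * x ord0 i * u (addpair j B) x.
Variable F : R -> R.
Hypothesis u0 : forall x, u finset.set0 x = F (rsq x).

Let e0 : 'rV[R]_m.+1 := delta_mx ord0 ord0.

(* [profile k] is [(-1)^k] times the [k]-th derivative of the radial profile;
   reading it off the coefficients [u] along a ray gives a function that is
   continuous on all of R, constant on the negative half-line. *)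
Definition profile k (s : R) : R := u (firstpairs n k) (Num.sqrt s *: e0).

Lemma continuous_line A (x v : 'rV[R]_m.+1) : continuous (fun t : R => u A (t *: v + x)).
Proof.
move=> t.
have [dt _] := is_derive_line (@du A (t *: v + x)).
by apply: differentiable_continuous; exact/derivable1_diffP.
Qed.

Lemma continuous_profile k : continuous (profile k).
Proof.
move=> s; rewrite /profile.
have -> : (fun s => u (firstpairs n k) (Num.sqrt s *: e0)) =
    (fun t => u (firstpairs n k) (t *: e0 + 0)) \o Num.sqrt.
  by apply/funext => t /=; rewrite addr0.
apply: continuous_comp; first exact: sqrt_continuous.
exact: continuous_line.
Qed.

Lemma is_derive_profile k (s : R) : (k < n)%N -> 0 < s ->
  is_derive s 1 (profile k) (- profile k.+1 s).
Proof.
move=> kn s0; rewrite /profile.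
have ss : 0 < Num.sqrt s by rewrite sqrtr_gt0.
have -> : (fun s => u (firstpairs n k) (Num.sqrt s *: e0)) =
    (fun t => u (firstpairs n k) (t *: e0 + 0)) \o Num.sqrt.
  by apply/funext => t /=; rewrite addr0.
have kn' : (2 * k < 2 * n)%N by rewrite ltn_pmul2l.
have [jN _] := firstpairs_notin kn'.
have [pk _] := firstpairsP (ltnW kn).
have D1 := is_derive_line (@du (firstpairs n k) (Num.sqrt s *: e0 + 0)).
have := is_derive1_comp D1 (is_derive1_sqrt s0).
rewrite -[('D_e0 _ _)]/(pderR ord0 _ _) (pu _ _ _ pk jN); last by rewrite /= mul2n odd_double.
rewrite -firstpairsS addr0 !mxE !eqxx mulr1.
set a := u _ _; set b := Num.sqrt s in ss a *.
(* The factor -2 x_0 of the mixed equation, taken at x_0 = sqrt s, cancels against the derivative 1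
   / (2 sqrt s) of the root. *)
suff -> : - 2 * b * a * (2 * b)^-1 = - a by [].
by field; rewrite gt_eqF.
Qed.

(** Remove a pair from [B] and differentiate the remaining coefficient, radial by induction, along
    an axis i with y_i != 0. The mixed equation gives -2 y_i u_B(y), the chain rule gives -2 y_i
    times the next profile at |y|^2, and y_i cancels. *)
Lemma profileE k B x : (k <= n)%N -> paired B -> npairs B = k ->
  u B x = profile k (rsq x).
Proof.
elim: k B x => [|k IH] B x kn pB nB.
  rewrite (paired_npairs0 pB nB) u0 /profile firstpairs0 u0 rsq_scale.
  by rewrite sqr_sqrtr// rsq_ge0.
have [j oj jB] : exists2 j : 'I_(2 * n), ~~ odd j & j \in B.
  by apply: npairs_pos; rewrite nB.
have pjB : partner j \in B by move/pairedP : (pB) => ->.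
pose B' := delpair j B.
have pB' : paired B' by rewrite paired_delpair.
have nB' : npairs B' = k by move: nB; rewrite (npairs_delpair oj jB pjB) => -[].
have jB' : j \notin B' by rewrite !inE eqxx andbF.
have off0 y : y != 0 -> u B y = profile k.+1 (rsq y).
  move=> y0; have [i yi] := rV0Pn _ y0.
  have := pu i y oj pB' jB'; rewrite delpairK// => E.
  have D1 := is_derive_line (@du B' (0 *: delta_mx ord0 i + y)).
  pose w (s : R) : R := rsq y + 2 * y ord0 i * s + s ^+ 2.
  have w0 : w 0 = rsq y by rewrite /w mulr0 expr0n !addr0.
  have E1 : (fun s : R => u B' (s *: delta_mx ord0 i + y)) = profile k \o w.
    by apply/funext => s /=; rewrite (IH B')// ?rsq_line// ltnW.
  have D2 : is_derive (0 : R) 1 w (2 * y ord0 i).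
    rewrite /w; apply: is_derive_eq.
    by rewrite !scale0r !addr0 add0r mul1r /GRing.scale/= mulr1.
  have D3 : is_derive (w 0) 1 (profile k) (- profile k.+1 (rsq y)).
    by rewrite w0; apply: is_derive_profile => //; exact: rsq_gt0.
  have D4 := is_derive1_comp D3 D2.
  have : 'D_(delta_mx ord0 i) (u B') y = - profile k.+1 (rsq y) * (2 * y ord0 i).
    move: D1; rewrite E1 => D1.
    have [_ <-] := D4.
    have [_ ->] := D1.
    by rewrite scale0r add0r.
  rewrite -[X in X = _]/(pderR i (u B') y) E => E2.
  apply: (mulfI yi); apply: (@mulfI _ (-2)); first by rewrite oppr_eq0 pnatr_eq0.
  rewrite mulrA E2; ring.
have [->|/off0//] := eqVneq x 0.
have rsq00 : rsq (0 : 'rV[R]_m.+1) = 0 by rewrite -(scale0r e0) rsq_scale expr0n.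
(* The origin has no nonzero coordinate; the identity is carried there by continuity along the first
   axis. *)
have c1 := cvg_at_right_filter (@continuous_line B 0 e0 0).
have c2 := cvg_at_right_filter (@continuous_line (firstpairs n k.+1) 0 e0 0).
have -> : u B 0 = u B (0 *: e0 + 0) by rewrite scale0r add0r.
have -> : profile k.+1 (rsq (0 : 'rV[R]_m.+1)) = u (firstpairs n k.+1) (0 *: e0 + 0).
  by rewrite rsq00 /profile sqrtr0 addr0.
have <- := cvg_lim (@Rhausdorff R) c1.
apply: (cvg_lim (@Rhausdorff R)).
apply: cvg_trans c2; apply: near_eq_cvg; near=> t.
have t0 : 0 < t by near: t; exact: nbhs_right_gt.
rewrite !addr0 off0; last by rewrite scaler_eq0 negb_or gt_eqF//=;
  apply/rV0Pn; exists ord0; rewrite !mxE !eqxx oner_eq0.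
by rewrite /profile rsq_scale sqrtr_sqr gtr0_norm.
Unshelve. all: by end_near. Qed.

End radial_structure.

(** * Real and imaginary parts *)

Section parts.
Variable R : realType.
Local Notation C := R[i].
Local Notation mu := (@lebesgue_measure R).

Definition cpart (b : bool) (z : C) : R := if b then complex.Re z else complex.Im z.

Lemma rC_mul (c : R) (z : C) :
  rC c * z = Complex (c * complex.Re z) (c * complex.Im z).
Proof. by case: z => a b; apply/eqP; rewrite eq_complex /= !mul0r subr0 addr0 !eqxx. Qed.

Lemma cpart_rC_mul b (c : R) (z : C) : cpart b (rC c * z) = c * cpart b z.
Proof. by rewrite rC_mul; case: b. Qed.

Lemma eq_cpart (z w : C) : (forall b, cpart b z = cpart b w) -> z = w.
Proof.
by move: z w => [a b] [c d] E; have := E true; have := E false => /= -> ->.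
Qed.

Lemma cpart_cint b m (g : 'rV[R]_m -> C) :
  cpart b (cint g) = iint (fun x => cpart b (g x)).
Proof. by case: b. Qed.

Lemma cpart_cderivn b k (f : R -> C) :
  (fun t => cpart b (cderivn k.+1 f t)) = (fun s => cpart b (cderivn k f s))^`().
Proof. by case: b. Qed.

(** [f] is tied to [g 0] only on [0, oo). Every t > 0 has a neighbourhood of positive numbers, so
    the two derivatives can be compared there, but not at 0. *)
Lemma cpart_cderivnE b n (g : nat -> R -> R) (f : R -> C) :
  (forall s, 0 <= s -> g 0%N s = cpart b (f s)) ->
  (forall k (s : R), (k < n)%N -> 0 < s -> is_derive s 1 (g k) (- g k.+1 s)) ->
  forall k t, (k <= n)%N -> 0 < t ->
  cpart b (cderivn k f t) = (-1) ^+ k * g k t.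
Proof.
move=> g0 dg; elim=> [|k IH] t kn t0.
  by rewrite expr0 mul1r g0 ?ltW.
rewrite -[LHS]/((fun t => cpart b (cderivn k.+1 f t)) t) cpart_cderivn.
rewrite derive1E (@near_eq_derive _ _ _ _ (fun s => (-1) ^+ k * g k s)); last first.
  near=> s; apply: IH; first exact: ltnW.
  by near: s; exact: lt_nbhsr.
have := dg k t kn t0 => dgk.
rewrite deriveM//= derive_val derive_cst /GRing.scale /=.
by rewrite mulr0 addr0 exprS mulN1r mulrN mulNr.
Unshelve. all: by end_near. Qed.

Lemma derivable_cpart_cderivn b n (g : nat -> R -> R) (f : R -> C) :
  (forall s, 0 <= s -> g 0%N s = cpart b (f s)) ->
  (forall k (s : R), (k < n)%N -> 0 < s -> is_derive s 1 (g k) (- g k.+1 s)) ->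
  forall k (t : R), (k < n)%N -> 0 < t ->
  derivable (fun s => cpart b (cderivn k f s)) t 1.
Proof.
move=> g0 dg k t kn t0.
apply: (@near_eq_derivable _ _ _ (fun s => (-1) ^+ k * g k s)).
  near=> s; apply/esym; apply: (cpart_cderivnE g0 dg); first exact: ltnW.
  by near: s; exact: lt_nbhsr.
by have [dgk _] := dg k t kn t0; apply: derivableM.
Unshelve. all: by end_near. Qed.

Lemma iint_profile (g : nat -> R -> R) n p q : (q <= n)%N ->
  (forall k, continuous (g k)) ->
  (forall k (s : R), (k < n)%N -> 0 < s -> is_derive s 1 (g k) (- g k.+1 s)) ->
  (forall k, (k <= n)%N -> (erint (p + 2 * q) (fun s => `|g k s|%:E) 0 < +oo)%E) ->
  iint (fun x : 'rV[R]_(p + 2 * q) => g n (rsq x)) =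
  pi ^+ q * iint (fun y : 'rV[R]_p => g (n - q)%N (rsq y)).
Proof.
move=> qn cg dg ig.
have E k l : iint (fun x : 'rV[R]_k => g l (rsq x)) = rint k (g l) 0.
  by rewrite -iint_rsq; congr iint; apply/funext => x; rewrite add0r.
by rewrite !E (rint_iter qn cg dg ig).
Qed.

Lemma invariant_radial m n (h : superfun R m n) (f : R -> C) (b : bool) :
  (0 < m)%N ->
  (forall A x, differentiable (fun y : 'rV[R]_m => complex.Re (h A y)) x /\
      differentiable (fun y : 'rV[R]_m => complex.Im (h A y)) x) ->
  (forall A, L1C (h A)) ->
  (forall k l : 'I_(m + 2 * n), (k <= l)%N -> forall A x, Lop k l h A x = 0) ->
  (forall x : 'rV[R]_m, body h x = f (rsq x)) ->
  exists g : nat -> R -> R,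
  [/\ forall k, continuous (g k),
      forall k (s : R), (k < n)%N -> 0 < s -> is_derive s 1 (g k) (- g k.+1 s),
      forall A x, paired A -> cpart b (h A x) = g (npairs A) (rsq x),
      forall s, 0 <= s -> g 0%N s = cpart b (f s) &
      forall k, (k <= n)%N -> (erint m (fun s => `|g k s|%:E) 0 < +oo)%E].
Proof.
case: m h => [//|m] h _ dh Lh Kh bh.
pose u A x := cpart b (h A x).
have du A x : differentiable (u A) x.
  by rewrite /u; case: (b); [exact: (dh A x).1|exact: (dh A x).2].
have pu i (j : 'I_(2 * n)) (B : {set 'I_(2 * n)}) x : ~~ odd j -> paired B -> j \notin B ->
    pderR i (u B) x = - 2 * x ord0 i * u (addpair j B) x.
  move=> oj pB jB.
  have L0 : Lop (lshift (2 * n) i) (rshift m.+1 j) h (j |: B) x = 0.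
    by apply: Kh; rewrite /= ltnW// (leq_trans (ltn_ord i))// leq_addr.
  have := Lop_mixed L0 oj pB jB => /(congr1 (cpart b)).
  by rewrite cpart_rC_mul => <-; rewrite /u; case: (b).
have u0 x : u finset.set0 x = cpart b (f (rsq x)) by rewrite /u -bh.
have uE k A x : (k <= n)%N -> paired A -> npairs A = k -> u A x = profile u k (rsq x).
  exact: (@profileE _ _ _ _ du pu (fun s => cpart b (f s)) u0).
exists (profile u); split.
- by move=> k; exact: continuous_profile.
- by move=> k s kn s0; exact: is_derive_profile.
- by move=> A x pA; apply: uE => //; exact: npairs_le.
- by move=> s s0; rewrite /profile firstpairs0 u0 rsq_scale sqr_sqrtr.
- move=> k kn; have [pk nk] := firstpairsP kn.
  have : L1R (u (firstpairs n k)).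
    by rewrite /u; case: (b); [exact: (Lh _).1|exact: (Lh _).2].
  rewrite /L1R -iint_pos_rsq.
  suff -> : (fun x => (`|u (firstpairs n k) x|)%:E) =
    (fun x : 'rV[R]_m.+1 => (`|profile u k (0 + rsq x)|)%:E) by [].
  by apply/funext => x; rewrite add0r (uE k).
Qed.

End parts.

Theorem theorem13 (R : realType) (m n : nat) (h : superfun R m n) :
  (0 < m)%N ->
  (* h is differentiable *)
  (forall (A : {set 'I_(2 * n)}) (x : 'rV[R]_m),
      differentiable (fun y : 'rV[R]_m => complex.Re (h A y)) x /\
      differentiable (fun y : 'rV[R]_m => complex.Im (h A y)) x) ->
  (* all coefficients lie in L_1(R^m) *)
  (forall A : {set 'I_(2 * n)}, L1C (h A)) ->
  (* L_ij h = 0 for all i <= j *)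
  (forall k l : 'I_(m + 2 * n), (k <= l)%N ->
      forall A x, Lop k l h A x = 0) ->
  forall f : R -> R[i],
  (forall x : 'rV[R]_m, body h x = f (rsq x)) ->
  [/\ (* the derivatives f', ..., f^(n) exist on (0, oo) *)
      (forall j : nat, (j < n)%N -> forall t : R, 0 < t ->
         derivable (fun s => complex.Re (cderivn j f s)) t 1 /\
         derivable (fun s => complex.Im (cderivn j f s)) t 1),
      (* h = f(R^2) *)
      (forall (A : {set 'I_(2 * n)}) (x : 'rV[R]_m), x != 0 ->
         h A x = @radial_sf R m n f A x),
      (* case M = m - 2n > 0 *)
      ((2 * n < m)%N ->
         berezin h = cint (fun y : 'rV[R]_(m - 2 * n) => f (rsq y))),
      (* case M = -2k, k >= 0 *)
      (forall k : nat, (m + 2 * k = 2 * n)%N ->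
         exists L : R[i],
           (complex.Re (cderivn k f t) @[t --> (0:R)^'+] --> complex.Re L) /\
           (complex.Im (cderivn k f t) @[t --> (0:R)^'+] --> complex.Im L) /\
           berezin h = rC ((- pi) ^- k) * L)
    & (* case M = -(2k+1), k >= 0 *)
      (forall k : nat, (m + 2 * k + 1 = 2 * n)%N ->
         berezin h =
           rC (2 * (- pi) ^- k.+1) *
           Complex
             (Rintegral (@lebesgue_measure R) `]0, +oo[
                (fun r => complex.Re (cderivn k.+1 f (r ^+ 2))))
             (Rintegral (@lebesgue_measure R) `]0, +oo[
                (fun r => complex.Im (cderivn k.+1 f (r ^+ 2)))))].
Proof.
move=> m0 dh Lh Kh f bh.
have [g gP] := choice (fun b => invariant_radial b m0 dh Lh Kh bh).
have g_cont b k : continuous (g b k) by have [] := gP b.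
have g_der b k (s : R) : (k < n)%N -> 0 < s -> is_derive s 1 (g b k) (- g b k.+1 s).
  by have [_ H _ _ _] := gP b; exact: H.
have g_h b A x : paired A -> cpart b (h A x) = g b (npairs A) (rsq x).
  by have [_ _ H _ _] := gP b; exact: H.
have g_f b s : 0 <= s -> g b 0%N s = cpart b (f s).
  by have [_ _ _ H _] := gP b; exact: H.
have g_int b k : (k <= n)%N -> (erint m (fun s => `|g b k s|%:E) 0 < +oo)%E.
  by have [_ _ _ _ H] := gP b; exact: H.
have fE b k t : (k <= n)%N -> 0 < t -> cpart b (cderivn k f t) = (-1) ^+ k * g b k t.
  exact: cpart_cderivnE (g_f b) (g_der b) k t.
have pi0 : (pi : R) != 0 by rewrite gt_eqF// pi_gt0.
have sgn k : (- pi : R) ^- k * (-1) ^+ k = pi ^- k.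
  by rewrite -[- pi]mulN1r exprMn invfM mulrAC -exprVn invrN1 -exprMn mulrNN mulr1 expr1n mul1r.
(* All three cases are instances: (p, q) is (m - 2n, n) for M > 0, (0, n - k) for M = -2k and (1, n
   - k - 1) for M = -(2k + 1). The q planar steps cancel pi^q against the Berezin constant pi^-n. *)
have bE b p q : (m = p + 2 * q)%N -> (q <= n)%N -> cpart b (berezin h) =
    pi ^- (n - q) * iint (fun y : 'rV[R]_p => g b (n - q)%N (rsq y)).
  move=> mE qn; rewrite berezinE cpart_rC_mul cpart_cint.
  have [pT nT] := firstpairsP (leqnn n); rewrite firstpairsT in pT nT.
  have -> : (fun x => cpart b (h [set: 'I_(2 * n)]%SET x)) = (fun x => g b n (rsq x)).
    by apply/funext => x; rewrite g_h// nT.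
  have ig k : (k <= n)%N -> (erint (p + 2 * q) (fun s => `|g b k s|%:E) 0 < +oo)%E.
    by rewrite -mE; exact: g_int.
  have -> : iint (fun x : 'rV[R]_m => g b n (rsq x)) =
      iint (fun x : 'rV[R]_(p + 2 * q) => g b n (rsq x)) by rewrite -mE.
  rewrite (iint_profile qn (g_cont b) (g_der b) ig) mulrA; congr (_ * _).
  rewrite -[in LHS](subnK qn) exprD invfM -mulrA mulVf ?mulr1//.
  by rewrite expf_neq0.
split.
- move=> k kn t t0; split.
  + exact: (derivable_cpart_cderivn (b := true) (g_f _) (g_der _)).
  + exact: (derivable_cpart_cderivn (b := false) (g_f _) (g_der _)).
- move=> A x x0; rewrite radial_sfE; case: ifPn => pA; last first.
    by apply: Lop_unpaired => // j B y; exact: Kh.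
  apply: eq_cpart => b; rewrite g_h//.
  have -> : (-1) ^+ npairs A = rC ((-1) ^+ npairs A) :> R[i].
    by rewrite rCE rmorphXn rmorphN1.
  rewrite cpart_rC_mul fE ?npairs_le ?rsq_gt0//.
  by rewrite mulrA -exprMn mulrNN mulr1 expr1n mul1r.
- move=> nm; apply: eq_cpart => b; rewrite cpart_cint.
  rewrite (bE b (m - 2 * n)%N n)//; last by rewrite subnK// ltnW.
  rewrite subnn expr0 invr1 mul1r; congr iint.
  by apply/funext => y; rewrite g_f// rsq_ge0.
- move=> k mk; have kn : (k <= n)%N by lia.
  (* The k-th derivative equals (-1)^k g_k for t > 0, and g_k is continuous at 0, so this is its
     right limit. *)
  exists (Complex ((-1) ^+ k * g true k 0) ((-1) ^+ k * g false k 0)).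
  have lim b : cpart b (cderivn k f t) @[t --> (0:R)^'+] --> (-1) ^+ k * g b k 0.
    have : (-1) ^+ k * g b k t @[t --> (0:R)^'+] --> (-1) ^+ k * g b k 0.
      by apply: cvgM; [exact: cvg_cst|apply: cvg_at_right_filter; exact: g_cont].
    apply: cvg_trans; apply: near_eq_cvg.
    by apply: filterS (nbhs_right_gt (0 : R)) => t t0; rewrite fE.
  split; first exact: (lim true).
  split; first exact: (lim false).
  apply: eq_cpart => b; rewrite (bE b 0%N (n - k)%N) ?leq_subr//; last by lia.
  rewrite subKn//= rsq0 cpart_rC_mul -(sgn k) -mulrA; congr (_ * _).
  by case: b.
- move=> k mk; have kn : (k < n)%N by lia.
  apply: eq_cpart => b; rewrite (bE b 1%N (n - k.+1)%N) ?leq_subr//; last by lia.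
  rewrite subKn// cpart_rC_mul.
  have -> : iint (fun y : 'rV[R]_1 => g b k.+1 (rsq y)) =
      Rintegral (@lebesgue_measure R) setT (fun t => g b k.+1 (t ^+ 2)).
    rewrite (_ : (fun y => _) = fun y : 'rV[R]_1 => g b k.+1 (0 + rsq y)).
      rewrite iint_rsq /=; apply: eq_Rintegral => t _; by rewrite add0r.
    by apply/funext => y; rewrite add0r.
  rewrite -(sgn k.+1) [2 * _]mulrC -!mulrA; congr (_ * _).
  (* The sign (-1)^(k+1) moves inside the integral, where it turns g_(k+1) back into the derivative
     of [f]; halving the line by evenness gives the factor 2. *)
  rewrite -RintegralTZl (@ge0_symfun_Rintegral R (fun s => (-1) ^+ k.+1 * g b k.+1 s)).
    congr (_ * _); transitivity (Rintegral (@lebesgue_measure R) `]0, +oo[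
        (fun r => cpart b (cderivn k.+1 f (r ^+ 2)))); last by case: b.
    apply: eq_Rintegral => t; rewrite inE/= in_itv/= andbT => t0.
    exact: esym (fE b k.+1 _ kn (exprn_gt0 2 t0)).
  by move=> s; apply: cvgM; [exact: cvg_cst|exact: g_cont].
Qed.
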